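(* Let $\mathcal{V}$ be a vector space over a field $\mathbb{F}$, let $L=\{0,1,\ldots,\ell\}$, and let $P=P_0P_1\cdots P_\ell:\mathcal{V}\to\mathcal{V}$ be an $\alpha$-decomposition, with associated operators $Q_J$, $J\in\alpha$. Fix $f\in\mathcal{V}$. There is a surjective mapping $B$ from the space of solutions $(u_J)_{J\in\alpha}\in\bigoplus^{|\alpha|}\mathcal{V}$ of the problem $$P_Ju_J=f,\quad J\in\alpha,$$ onto the space of solutions $u\in\mathcal{V}$ of $Pu=f$. More precisely, write $\mathcal{V}_P^f$ for the solution space of $Pu=f$ and, for $J\in\alpha$, $\mathcal{V}_J^f$ for the solution space of $P_J\tilde u=f$. The map $B:\times_{J\in\alpha}\mathcal{V}_J^f\to\mathcal{V}_P^f$ is given by $$(u_J)_{J\in\alpha}\mapsto\sum_{J\in\alpha}Q_Ju_J.$$ A right inverse for $B$ is $F:\mathcal{V}_P^f\to\times_{J\in\alpha}\mathcal{V}_J^f$ given component-wise by $u\mapsto P^Ju$; on $\mathcal{V}$ (with $F$, $B$ given by the same formulae) we have $B\circ F=\mathrm{id}_{\mathcal{V}}$. If $\alpha$ satisfies $I\cap J=\emptyset$ for all $I\ne J\in\alpha$, then $F$ is a 1-1 mapping and $F\circ B$ is the identity on the solution space of the problem $P_Ju_J=f$, $J\in\alpha$.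
   Context: For $J\subseteq L$ write $P_J:=\prod_{j\in J}P_j$ (with $P_\emptyset:=\mathrm{id}_{\mathcal{V}}$) and $P^J:=P_{L\setminus J}$. Definition ($\alpha$-decomposition): let $\emptyset\ne\alpha\subseteq2^L$ with $L\notin\alpha$. An expression $P=P_0P_1\cdots P_\ell$ as a composition of linear operators $P_i:\mathcal{V}\to\mathcal{V}$ is an $\alpha$-decomposition of $P$ if there exist linear operators $Q_J:\mathcal{V}\to\mathcal{V}$, $J\in\alpha$, such that $$\mathrm{id}_{\mathcal{V}}=\sum_{J\in\alpha}Q_JP^J,$$ and $P_iP_j=P_jP_i$, $P_iQ_J=Q_JP_i$ for all $i,j\in L$, $J\in\alpha$. *)

(* Defs.v *)
From mathcomp Require Import all_boot all_order all_algebra.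
From mathcomp Require Import boolp classical_sets functions.

Set Implicit Arguments.
Unset Strict Implicit.
Unset Printing Implicit Defensive.

Import GRing.Theory.
Local Open Scope ring_scope.

Section AlphaDecomposition.
Variables (K : fieldType) (V : lmodType K) (l : nat).
Implicit Types (P : 'I_l.+1 -> {linear V -> V}) (J : {set 'I_l.+1}).
Implicit Types (alpha : {set {set 'I_l.+1}}) (f u : V).

(* The index set L is 'I_l.+1. Factors are composed in increasing order of
   their index, so that [Pprod P [set: 'I_l.+1]] is P_0 \o P_1 \o ... \o P_l. *)
Definition Pprod P J : V -> V := \big[(fun g h : V -> V => g \o h)/id]_(j in J) P j.

(* P^J *)
Definition Pcoprod P J : V -> V := Pprod P (~: J).

(* Families (x_J)_{J \in alpha} are indexed by the members of alpha only. *)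
Definition member alpha : finType := {J : {set 'I_l.+1} | J \in alpha}.

(* [PL = P_0 P_1 ... P_l] is an alpha-decomposition of the operator [PL], with
   associated operators [Q_J], [J \in alpha]. *)
Record alpha_decomposition alpha (PL : {linear V -> V}) P
    (Q : member alpha -> {linear V -> V}) : Prop := AlphaDecomposition {
  alpha_neq0 : alpha != finset.set0;
  alpha_proper : finset.setTfor 'I_l.+1 \notin alpha;
  PL_factor : PL =1 Pprod P (finset.setTfor 'I_l.+1);
  sum_QP : id =1 (fun x : V => \sum_(J : member alpha) Q J (Pcoprod P (val J) x));
  comm_PP : forall i j, P i \o P j =1 P j \o P i;
  comm_PQ : forall i (J : member alpha), P i \o Q J =1 Q J \o P i }.

Definition sol (T : V -> V) f : set V := [set u | T u = f]%classic.

(* The solution set of the system P_J u_J = f (J \in alpha), i.e. the product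
   of the solution sets of the individual equations. *)
Definition sol_sys alpha P f : set {ffun member alpha -> V} :=
  [set u | forall J : member alpha, sol (Pprod P (val J)) f (u J)]%classic.

Definition Bmap alpha (Q : member alpha -> {linear V -> V})
    (u : {ffun member alpha -> V}) : V :=
  \sum_(J : member alpha) Q J (u J).

Definition Fmap alpha P (u : V) : {ffun member alpha -> V} :=
  [ffun J : member alpha => Pcoprod P (val J) u].

End AlphaDecomposition.

(* Main.v *)
Require Import Defs.
From mathcomp Require Import all_boot all_order all_algebra.
From mathcomp Require Import boolp classical_sets functions.

(** The relation [id = \sum_J Q_J P^J] is a partition of unity. It splits every
    [u] into the pieces [Q_J P^J u], which is [B (F u) = u] on all of [V], and
    surjectivity of [B] follows once [F] and [B] are known to preserve solutions.
    That they do rests on one algebraic fact, [Pprod_setU]: since the factors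
    commute, [P_(A \cup B) = P_A P_B] for disjoint [A] and [B]. For [F] this gives
    [P_J P^J u = P u = f], and for [B] it gives
    [P (\sum_J Q_J u_J) = \sum_J Q_J P^J P_J u_J = \sum_J Q_J P^J f = f].

    When the members of [alpha] are pairwise disjoint, any two components [u_I]
    and [u_J], [I <> J], of a solution of the system satisfy
    [P^I u_J = P^J u_I] ([Pcoprod_exchange]). Hence
    [P^I (B u) = \sum_J Q_J P^I u_J = \sum_J Q_J P^J u_I = u_I], that is
    [F (B u) = u]. *)

Set Implicit Arguments.
Unset Strict Implicit.
Unset Printing Implicit Defensive.

Import GRing.Theory.
Local Open Scope ring_scope.

Section ProductsOfCommutingFactors.
Variables (K : fieldType) (V : lmodType K) (l : nat).
Variable P : 'I_l.+1 -> {linear V -> V}.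
Implicit Types (A B I J : {set 'I_l.+1}).

Lemma Pprod_additive J : {morph Pprod P J : x y / x + y}.
Proof.
rewrite /Pprod; elim/big_ind: _ => // [g h gD hD x y | j _ x y].
  by rewrite /= hD gD.
exact: linearD.
Qed.

Lemma Pprod_sum J (I : finType) (x : I -> V) :
  Pprod P J (\sum_i x i) = \sum_i Pprod P J (x i).
Proof.
apply: (big_morph _ (@Pprod_additive J)).
by apply: (addrI (Pprod P J 0)); rewrite -Pprod_additive !addr0.
Qed.

Lemma Pprod_comm J (g : V -> V) :
  (forall i, P i \o g =1 g \o P i) -> Pprod P J \o g =1 g \o Pprod P J.
Proof.
move=> Pg; rewrite /Pprod; elim/big_ind: _ => // h k hg kg x.
by rewrite /= [k (g x)]kg [h (g _)]hg.
Qed.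

Hypothesis commP : forall i j, P i \o P j =1 P j \o P i.

(** Composition of operators is not a commutative monoid law, so splitting of the
    index set is proved by running through the increasing list of indices: a
    factor whose index lies in [B] is moved past all the later factors with index
    in [A]. *)
Lemma Pprod_setU A B :
  [disjoint A & B] -> Pprod P (A :|: B) =1 Pprod P A \o Pprod P B.
Proof.
move=> dAB; rewrite /Pprod (eq_bigl _ _ (fun j => finset.in_setU j A B)).
elim: (index_enum _) => [|i s IHs] x; first by rewrite !big_nil.
rewrite !big_cons.
have [iA | iA] := boolP (i \in A).
  by rewrite (disjointFr dAB iA) /= IHs.
have [iB | iB] /= := boolP (i \in B); last by rewrite IHs.
rewrite IHs /=; move: (\big[_/_]_(j <- s | j \in B) _) => h.
by elim/big_ind: _ (h x) => // [g k Pg Pk y | j _ y];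
  [rewrite /= Pg Pk | exact: commP].
Qed.

Lemma Pprod_setC J x :
  Pprod P J (Pcoprod P J x) = Pprod P [set: 'I_l.+1] x.
Proof. by rewrite -(finset.setUCr J) Pprod_setU // -finset.subsets_disjoint. Qed.

Lemma Pcoprod_setC J x :
  Pcoprod P J (Pprod P J x) = Pprod P [set: 'I_l.+1] x.
Proof.
by rewrite -(finset.setUCr J) finset.setUC Pprod_setU // disjoint_sym
  -finset.subsets_disjoint.
Qed.

(** This compatibility between the components of a solution is what makes [B]
    injective. With [M] the complement of [I :|: J], disjointness gives
    [P^I = P_M P_J] and [P^J = P_M P_I], so both sides are [P_M f]. *)
Lemma Pcoprod_exchange I J f x y :
    [disjoint I & J] -> Pprod P I x = f -> Pprod P J y = f ->
  Pcoprod P I y = Pcoprod P J x.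
Proof.
have split_coprod A B z : [disjoint A & B] ->
    Pcoprod P A z = Pprod P (~: (A :|: B)) (Pprod P B z).
  move=> dAB; rewrite -[RHS]/((_ \o _) z) -Pprod_setU; last first.
    by rewrite disjoint_sym -finset.subsets_disjoint finset.subsetUr.
  congr (Pprod P _ z); apply/setP=> i; rewrite !inE.
  by case: (boolP (i \in A)) => [/(disjointFr dAB)->|]; case: (i \in B).
move=> dIJ xf yf; rewrite (split_coprod I J) // (split_coprod J I).
  by rewrite yf xf finset.setUC.
by rewrite disjoint_sym.
Qed.

End ProductsOfCommutingFactors.

Section SolutionMaps.
Variables (K : fieldType) (V : lmodType K) (l : nat).
Variables (alpha : {set {set 'I_l.+1}}) (PL : {linear V -> V}).
Variables (P : 'I_l.+1 -> {linear V -> V}).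
Variables (Q : member alpha -> {linear V -> V}).
Hypothesis hPQ : alpha_decomposition PL P Q.

Let Pprod_Q A (J : member alpha) x : Pprod P A (Q J x) = Q J (Pprod P A x).
Proof. exact: (Pprod_comm _ (fun i => comm_PQ hPQ i J)). Qed.

Lemma FmapK : cancel (Fmap alpha P) (Bmap Q).
Proof.
by move=> u; rewrite [RHS](sum_QP hPQ); apply: eq_bigr => J _; rewrite ffunE.
Qed.

Lemma Fmap_sol f : set_fun (sol PL f) (sol_sys P f) (Fmap alpha P).
Proof.
move=> u uf J; rewrite /sol /= ffunE (Pprod_setC (comm_PP hPQ)).
by rewrite -(PL_factor hPQ).
Qed.

Lemma Bmap_sol f : set_fun (sol_sys P f) (sol PL f) (Bmap Q).
Proof.
move=> u uf; rewrite /sol /= (PL_factor hPQ) Pprod_sum [RHS](sum_QP hPQ).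
apply: eq_bigr => J _.
by rewrite Pprod_Q -(Pcoprod_setC (comm_PP hPQ) (val J)) uf.
Qed.

Lemma BmapK f :
    (forall I J, I \in alpha -> J \in alpha -> I != J -> I :&: J = finset.set0) ->
  {in sol_sys P f, cancel (Bmap Q) (Fmap alpha P)}.
Proof.
move=> disj u /set_mem uf; apply/ffunP=> I; rewrite ffunE.
rewrite /Pcoprod Pprod_sum [RHS](sum_QP hPQ); apply: eq_bigr => J _.
rewrite Pprod_Q; congr (Q J _).
have [-> // | neqIJ] := eqVneq I J.
apply: (Pcoprod_exchange (comm_PP hPQ) _ (uf I) (uf J)).
by rewrite -finset.setI_eq0; apply/eqP; apply: disj => //; apply: valP.
Qed.

End SolutionMaps.

Theorem theorem2p10 (K : fieldType) (V : lmodType K) (l : nat)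
    (alpha : {set {set 'I_l.+1}}) (PL : {linear V -> V})
    (P : 'I_l.+1 -> {linear V -> V}) (Q : member alpha -> {linear V -> V})
    (f : V) (hPQ : alpha_decomposition PL P Q) :
  [/\ set_fun (sol_sys P f) (sol PL f) (Bmap Q),
      set_surj (sol_sys P f) (sol PL f) (Bmap Q),
      set_fun (sol PL f) (sol_sys P f) (Fmap alpha P),
      {in sol PL f, cancel (Fmap alpha P) (Bmap Q)} &
      cancel (Fmap alpha P) (Bmap Q)] /\
  ((forall I J, I \in alpha -> J \in alpha -> I != J -> I :&: J = finset.set0) ->
     set_bij (sol PL f) (sol_sys P f) (Fmap alpha P) /\
     {in sol_sys P f, cancel (Bmap Q) (Fmap alpha P)}).
Proof.
have FB := FmapK hPQ; have Fsol := Fmap_sol hPQ (f := f).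
have Bsol := Bmap_sol hPQ (f := f).
split=> [|disj].
  by split=> // u uf; exists (Fmap alpha P u); [exact: Fsol | exact: FB].
have BF := BmapK hPQ (f := f) disj.
split=> //; split=> // [u v _ _ | u uf]; first exact: (can_inj FB).
by exists (Bmap Q u); [exact: Bsol | exact/BF/mem_set].
Qed.
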